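(* If $(\mathbb V,\operatorname{dist})$ is a complete metric space, then the metric space $(\mathcal{DS}(\mathbb V),\mathrm{D_H})$ is complete.
   Context: For a metric space $(N,\operatorname{dist})$, $\mathcal K(N)$ is the set of nonempty compact subsets of $N$, with the Hausdorff distance $\operatorname{dist}_H(X,Y)=\inf\{\epsilon>0: X\subseteq B_\epsilon(Y),\ Y\subseteq B_\epsilon(X)\}$, where $B_\epsilon(X)=\bigcup_{x\in X}B_\epsilon(x)$. On $\mathbb V^2=\mathbb V\times\mathbb V$ use the max-metric $\operatorname{dist}_2((a,b),(c,d))=\max\{\operatorname{dist}(a,c),\operatorname{dist}(b,d)\}$, and let $\pi_1,\pi_2:\mathbb V^2\to\mathbb V$ be the coordinate projections. Define $\mathcal{DS}(\mathbb V)=\{f\in\mathcal K(\mathbb V^2):\pi_1(f)=\pi_2(f)\}$, and let $\mathrm{D_H}$ be the Hausdorff distance on $\mathcal K(\mathbb V^2)$ associated to $\operatorname{dist}_2$, restricted to $\mathcal{DS}(\mathbb V)$. *)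

(* Defs.v *)
From HB Require Import structures.
From mathcomp Require Import all_boot all_order all_algebra.
From mathcomp Require Import all_classical all_reals all_analysis.

Set Implicit Arguments.
Unset Strict Implicit.
Unset Printing Implicit Defensive.

Import Order.TTheory GRing.Theory Num.Theory.
Import numFieldNormedType.Exports.

Local Open Scope classical_set_scope.
Local Open Scope ring_scope.

(* Every Cauchy sequence converges.  The library's [completeType] is not used
   because it requires a distinguished point, so it excludes the empty space. *)
Definition metric_complete (R : realType) (M : metricType R) : Prop :=
  forall u : nat -> M, cauchy (u @ \oo) -> exists l : M, u @ \oo --> l.

(* The library already puts a pseudometric structure on products, with balls
   [ball x.1 e `*` ball x.2 e]; the max-metric induces exactly these balls. *)
Section prod_metric.
Context {R : realType} {M N : metricType R}.
Implicit Types x y : M * N.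

Definition prod_mdist x y : R := Num.max (mdist x.1 y.1) (mdist x.2 y.2).

Let prod_mdist_ge0 x y : 0 <= prod_mdist x y.
Proof. by rewrite /prod_mdist le_max mdist_ge0. Qed.

Let prod_mdist_positivity x y : prod_mdist x y = 0 -> x = y.
Proof.
case: x y => [a b] [c d]; rewrite /prod_mdist /= => m0.
have ac : mdist a c = 0.
  by apply/eqP; rewrite eq_le mdist_ge0 andbT -m0 le_max lexx.
have bd : mdist b d = 0.
  by apply/eqP; rewrite eq_le mdist_ge0 andbT -m0 le_max lexx orbT.
by rewrite (mdist_positivity _ _ ac) (mdist_positivity _ _ bd).
Qed.

Let prod_ballEmdist x (d : R) : ball x d = [set y | prod_mdist x y < d].
Proof.
apply/seteqP; split => y; rewrite /ball /= /prod_ball /prod_mdist gt_max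
  !ballEmdist /=; first by case=> -> ->.
by move/andP.
Qed.

HB.instance Definition _ := PseudoMetric_isMetric.Build R (M * N)%type
  prod_mdist_ge0 prod_mdist_positivity prod_ballEmdist.

End prod_metric.

Definition set_ball (R : realType) (N : metricType R) (X : set N) (e : R)
  : set N := \bigcup_(x in X) ball x e.

Definition hausdorff_dist (R : realType) (N : metricType R) (X Y : set N) : R :=
  inf [set e : R | [/\ 0 < e, X `<=` set_ball Y e & Y `<=` set_ball X e]].

Record nonempty_compact (R : realType) (N : metricType R) := NonemptyCompact {
  compact_carrier :> set N ;
  compact_carrierP : compact compact_carrier ;
  compact_carrier_neq0 : compact_carrier !=set0 }.
Arguments compact_carrierP {R N} _.
Arguments compact_carrier_neq0 {R N} _.

Section nonempty_compact_metric.
Context {R : realType} {N : metricType R}.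
Implicit Types X Y Z : nonempty_compact N.

Lemma nonempty_compact_inj X Y : X = Y :> set N -> X = Y.
Proof.
case: X Y => [X cX X0] [Y cY Y0] /= XY; subst Y.
by congr NonemptyCompact; exact: Prop_irrelevance.
Qed.

HB.instance Definition _ := gen_eqMixin (nonempty_compact N).
HB.instance Definition _ := gen_choiceMixin (nonempty_compact N).

Let adm (X Y : set N) : set R :=
  [set e : R | [/\ 0 < e, X `<=` set_ball Y e & Y `<=` set_ball X e]].

Let adm_lb (X Y : set N) : lbound (adm X Y) 0.
Proof. by move=> e [/ltW]. Qed.

Let compact_sub_set_ball X Y :
  \forall n \near \oo, X `<=` set_ball Y n.+1%:R.
Proof.
have [y0 Yy0] := compact_carrier_neq0 Y.
have /compact_near_coveringP cX := compact_carrierP X.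
apply: (cX _ _ (fun (n : nat) (x : N) => set_ball Y n.+1%:R x)) => x Xx.
have [m Hm] : exists m : nat, mdist y0 x + 1 < m%:R.
  by exists (Num.bound (mdist y0 x + 1)); rewrite archi_boundP// addr_ge0// mdist_ge0.
exists (ball x 1, [set n | (m <= n)%N]).
  by split; [exact: nbhsx_ballx|exists m].
case=> z n [/= xz mn]; exists y0 => //; rewrite ballEmdist /=.
apply: (le_lt_trans (metric_triangle y0 x z)).
rewrite ballEmdist /= in xz.
apply: (lt_trans (y := mdist y0 x + 1)); first by rewrite ltrD2l.
by apply: (lt_le_trans Hm); rewrite ler_nat (leq_trans mn).
Qed.

Let adm_neq0 X Y : adm X Y !=set0.
Proof.
near \oo => n; exists n.+1%:R; split; first by rewrite ltr0n.
- by near: n; exact: compact_sub_set_ball.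
- by near: n; exact: compact_sub_set_ball.
Unshelve. all: by end_near. Qed.

Let adm_le (X Y : set N) (e e' : R) : e <= e' -> adm X Y e -> adm X Y e'.
Proof.
move=> ee' [e0 XY YX]; split; first exact: lt_le_trans ee'.
- by move=> x /XY[y Yy yx]; exists y => //; exact: le_ball yx.
- by move=> x /YX[y Yy yx]; exists y => //; exact: le_ball yx.
Qed.

Let adm_lt X Y (e : R) : hausdorff_dist X Y < e -> adm X Y e.
Proof.
by move=> /(inf_lt (adm_neq0 X Y))[d dXY /ltW de]; exact: adm_le dXY.
Qed.

Let adm_ge (X Y : set N) (e : R) : adm X Y e -> hausdorff_dist X Y <= e.
Proof. by move=> XYe; apply: ge_inf => //; exists 0; exact: adm_lb. Qed.

Let hausdorff_dist_xx X : hausdorff_dist X X = 0.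
Proof.
apply/eqP; rewrite eq_le; apply/andP; split; last first.
  by apply: lb_le_inf; [exact: adm_neq0|exact: adm_lb].
apply/ler_addgt0Pl => e e0; rewrite addr0; apply: adm_ge.
by split => // x Xx; exists x => //; exact: ballxx.
Qed.

Let hausdorff_dist_sub X Y : hausdorff_dist X Y = 0 -> X `<=` Y.
Proof.
move=> XY0 x Xx.
have /closure_id -> : closed Y.
  apply: compact_closed (compact_carrierP Y); exact: metric_hausdorff.
move=> B /nbhs_ballP[e /= e0 xeB].
have [_ /(_ _ Xx)[y Yy yx] _] : adm X Y e by apply: adm_lt; rewrite XY0.
by exists y; split => //; apply: xeB; exact: ball_sym.
Qed.

Let hausdorff_dist_sym X Y : hausdorff_dist X Y = hausdorff_dist Y X.
Proof. by congr inf; apply/seteqP; split => e [? ? ?]. Qed.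

Let hausdorff_dist_positivity X Y : hausdorff_dist X Y = 0 -> X = Y.
Proof.
move=> XY0; apply: nonempty_compact_inj; apply/seteqP; split.
  exact: hausdorff_dist_sub.
by apply: hausdorff_dist_sub; rewrite hausdorff_dist_sym.
Qed.

Let hausdorff_dist_triangle Y X Z :
  hausdorff_dist X Z <= hausdorff_dist X Y + hausdorff_dist Y Z.
Proof.
apply/ler_addgt0Pr => e e0.
have e20 : 0 < e / 2 by rewrite divr_gt0.
have [d0 XY YX] : adm X Y (hausdorff_dist X Y + e / 2).
  by apply: adm_lt; rewrite ltrDl.
have [d0' YZ ZY] : adm Y Z (hausdorff_dist Y Z + e / 2).
  by apply: adm_lt; rewrite ltrDl.
rewrite [e in leRHS]splitr addrACA; apply: adm_ge; split.
- exact: addr_gt0.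
- move=> x /XY[y /YZ[z Zz zy] yx]; exists z => //.
  by rewrite addrC; exact: ball_triangle zy yx.
- move=> z /ZY[y /YX[x Xx xy] yz]; exists x => //.
  exact: ball_triangle xy yz.
Qed.

HB.instance Definition _ := isMetric.Build R (nonempty_compact N)
  hausdorff_dist_xx hausdorff_dist_positivity hausdorff_dist_sym
  hausdorff_dist_triangle.

End nonempty_compact_metric.

Record DS (R : realType) (V : metricType R) := MkDS {
  DS_compact :> nonempty_compact (V * V)%type ;
  DS_proj : fst @` (DS_compact : set (V * V)) =
            snd @` (DS_compact : set (V * V)) }.

Section DS_metric.
Context {R : realType} {V : metricType R}.
Implicit Types f g h : DS V.

HB.instance Definition _ := gen_eqMixin (DS V).
HB.instance Definition _ := gen_choiceMixin (DS V).

Definition DS_dist f g : R := hausdorff_dist f g.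

Let DS_dist_xx f : DS_dist f f = 0.
Proof. exact: mdistxx (DS_compact f). Qed.

Let DS_dist_positivity f g : DS_dist f g = 0 -> f = g.
Proof.
move=> /(@mdist_positivity _ _ (DS_compact f) (DS_compact g)).
case: f g => [f fP] [g gP] /= fg; subst g.
by congr MkDS; exact: Prop_irrelevance.
Qed.

Let DS_dist_sym f g : DS_dist f g = DS_dist g f.
Proof. exact: (metric_sym (DS_compact f) (DS_compact g)). Qed.

Let DS_dist_triangle g f h : DS_dist f h <= DS_dist f g + DS_dist g h.
Proof.
exact: (metric_triangle (DS_compact f) (DS_compact g) (DS_compact h)).
Qed.

HB.instance Definition _ := isMetric.Build R (DS V)
  DS_dist_xx DS_dist_positivity DS_dist_sym DS_dist_triangle.

End DS_metric.

Lemma nonempty_compact_mdistE (R : realType) (N : metricType R)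
  (X Y : nonempty_compact N) : mdist X Y = hausdorff_dist X Y.
Proof. by []. Qed.

Lemma DS_mdistE (R : realType) (V : metricType R) (f g : DS V) :
  mdist f g = hausdorff_dist f g.
Proof. by []. Qed.

(* Main.v *)
Require Import Defs.
From mathcomp Require Import all_boot all_order all_algebra.
From mathcomp Require Import all_classical all_reals all_analysis.

Set Implicit Arguments.
Unset Strict Implicit.
Unset Printing Implicit Defensive.

Import Order.TTheory GRing.Theory Num.Theory.

Local Open Scope classical_set_scope.
Local Open Scope ring_scope.

(** The space DS(V) is a closed subspace of the hyperspace K(V * V) of nonempty
compact sets, so two things are at stake: completeness of K(N) for a complete
N, and closedness of the condition that both projections agree.

Completeness of K(N) ([nonempty_compact_complete]).  The limit of a Cauchy
sequence X of compact sets is its upper limit L, the set of points every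
neighbourhood of which meets X m for arbitrarily large m.  Three facts are
needed, and two of them rest on one convergence criterion
([ultra_near_compact_cvg]): an ultrafilter that, for every e > 0, contains the
e-neighbourhood of some compact set converges, since it contains arbitrarily
small balls and is therefore a Cauchy filter.
- L is close to X n for large n: a point of L is near a point of some later
  X m, which is near a point of X n ([limit_set_sub]).
- L is compact: an ultrafilter on L satisfies the criterion, because L lies in
  the e-neighbourhood of the compact set X n, and L is closed
  ([limit_set_compact]).
- X n is close to L for large n: for x in X n choose y m in every later X m
  within a fixed distance of x; an ultrafilter finer than the tails of y
  satisfies the criterion again, because the tails of y lie near a single X n,
  and its limit is a point of L near x ([sub_limit_set]).  The ultrafilter
  replaces the usual construction of a rapidly converging sequence x, y 1,
  y 2, ... by successive choices.

Closedness ([image_sub_limit]).  The projections are 1-Lipschitz, so an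
inclusion of the image of X n under one of them in the image under the other
passes, up to an arbitrarily small error, to the Hausdorff limit L; the error
disappears because the images of L are compact, hence closed. *)

Lemma set_ballW (R : realType) (N : metricType R) (X : set N) (d e : R) :
  d <= e -> set_ball X d `<=` set_ball X e.
Proof. by move=> de x [y Xy yx]; exists y => //; exact: le_ball yx. Qed.

(** Completeness is given for sequences, while the ultrafilter arguments below
need it for filters.  A Cauchy filter contains a ball of radius 1 / (k + 1) for
each k; any two members of a filter meet, so the centres form a Cauchy
sequence, and the filter follows the centres to their limit. *)
Lemma complete_cvg_cauchy (R : realType) (N : metricType R)
    (F : set_system N) :
  metric_complete N -> ProperFilter F -> cauchy F -> exists l : N, F --> l.
Proof.
move=> cN PF /cauchyP Fball.
have /choice[c cF] (k : nat) : exists x, F (ball x (k.+1%:R^-1 : R)).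
  by apply: Fball; rewrite invr_gt0 ltr0n.
have [l cl] : exists l : N, c @ \oo --> l.
  apply: cN; apply/cauchy_ballP => e e0; rewrite near_map2.
  have e20 : 0 < e / 2 by rewrite divr_gt0.
  near=> m n => /=.
  have [z [mz nz]] := filter_ex (filterI (cF m) (cF n)).
  have {}mz : ball (c m) (e / 2) z.
    apply: le_ball mz; apply: ltW; near: m.
    exact: near_infty_natSinv_lt (PosNum e20).
  have {}nz : ball (c n) (e / 2) z.
    apply: le_ball nz; apply: ltW; near: n.
    exact: near_infty_natSinv_lt (PosNum e20).
  exact: ball_splitl mz nz.
exists l; apply/fcvg_ballP => e e0.
have e20 : 0 < e / 2 by rewrite divr_gt0.
near \oo => k.
have lk : ball l (e / 2) (c k) by near: k; exact: cvg_ball cl _ e20.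
apply: filterS (cF k) => z kz; rewrite [e]splitr; apply: ball_triangle lk _.
apply: le_ball kz; apply: ltW; near: k.
exact: near_infty_natSinv_lt (PosNum e20).
Unshelve. all: by end_near. Qed.

(** The compactness criterion behind everything else.  Send each point of the
e / 2-neighbourhood of K to a point of K at distance less than e / 2.  The
image filter clusters at some x in K, so every member of F meets the ball of
radius e around x, and an ultrafilter contains any set that meets all its
members.  Hence F contains arbitrarily small balls. *)
Lemma ultra_near_compact_cvg (R : realType) (N : metricType R)
    (F : set_system N) :
  metric_complete N -> UltraFilter F ->
  (forall e : R, 0 < e -> exists2 K : set N, compact K & F (set_ball K e)) ->
  exists l : N, F --> l.
Proof.
move=> cN UF FK; apply: complete_cvg_cauchy => //.
apply/cauchy_exP => e e0.
have e20 : 0 < e / 2 by rewrite divr_gt0.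
have [K cK FKe] := FK _ e20.
have /choice[p pP] (z : N) :
    exists q, set_ball K (e / 2) z -> K q /\ ball q (e / 2) z.
  have [[q Kq qz]|nz] := pselect (set_ball K (e / 2) z); first by exists q.
  by exists z.
have [x [Kx xcl]] : K `&` cluster (p @ F) !=set0.
  apply: (cK (p @ F)); change (F (p @^-1` K)).
  by apply: filterS FKe => z /pP[].
exists x; have [//|FnB] := in_ultra_setVsetC (ball x e) UF.
have : (p @ F) (p @` (set_ball K (e / 2) `&` ~` ball x e)).
  change (F (p @^-1` (p @` (set_ball K (e / 2) `&` ~` ball x e)))).
  by apply: filterS (filterI FKe FnB) => z ?; exists z.
move=> /xcl/(_ (nbhsx_ballx x _ e20))[_ [[z [/pP[_ pz] nxz] <-] xp]].
exfalso; apply: nxz.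
by rewrite [e]splitr; exact: ball_triangle xp pz.
Qed.

Section limit_set.
Context {R : realType} {N : metricType R}.
Variable X : nat -> set N.

(** The topological upper limit (Kuratowski limsup) of the sequence.  For a
Cauchy sequence it agrees with the lower limit; this form makes closedness
immediate and turns limits of ultrafilters into members. *)
Definition limit_set : set N :=
  \bigcap_n closure (\bigcup_(m in [set m | (n <= m)%N]) X m).

Hypothesis X_cauchy : forall e : R, 0 < e ->
  \forall m & n \near \oo, X m `<=` set_ball (X n) e.

Lemma limit_set_closed : closed limit_set.
Proof. by apply: closed_bigI => n _; exact: closed_closure. Qed.

Let X_cauchy_ex (e : R) : 0 < e ->
  exists n0, forall m n, (n0 <= m)%N -> (n0 <= n)%N -> X m `<=` set_ball (X n) e.
Proof.
move=> /X_cauchy[[A B] [[a _ Aa] [b _ Bb]] AB].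
exists (maxn a b) => m n; rewrite !geq_max => /andP[am _] /andP[_ bn].
by apply: (AB (m, n)); split; [exact: Aa|exact: Bb].
Qed.

Lemma limit_set_sub (e : R) : 0 < e ->
  \forall n \near \oo, limit_set `<=` set_ball (X n) e.
Proof.
move=> e0; have e20 : 0 < e / 2 by rewrite divr_gt0.
have [n0 Xn0] := X_cauchy_ex e20.
exists n0 => // n /= n0n x Lx.
have [z [[m /= nm Xmz] xz]] := Lx n I _ (nbhsx_ballx x _ e20).
have [y Xny yz] := Xn0 _ _ (leq_trans n0n nm) n0n _ Xmz.
by exists y => //; exact: ball_splitl yz xz.
Qed.

Hypothesis N_complete : metric_complete N.
Hypothesis X_compact : forall n, compact (X n).

Lemma limit_set_compact : compact limit_set.
Proof.
rewrite compact_ultra => F UF FL.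
have [l Fl] : exists l : N, F --> l.
  apply: ultra_near_compact_cvg => // e /limit_set_sub[n0 _ Ln0].
  by exists (X n0) => //; apply: filterS FL; exact: Ln0 (leqnn n0).
exists l; split=> //; apply: limit_set_closed => B /Fl FB.
exact: filter_ex (filterI FL FB).
Qed.

Hypothesis X_neq0 : forall n, X n !=set0.

(** The one place where points of the limit must be produced rather than
approximated.  This also shows that the limit is nonempty. *)
Lemma sub_limit_set (e : R) : 0 < e ->
  \forall n \near \oo, X n `<=` set_ball limit_set e.
Proof.
move=> e0; have e20 : 0 < e / 2 by rewrite divr_gt0.
have [n0 Xn0] := X_cauchy_ex e20.
exists n0 => // n /= n0n x Xx.
(* Before n0 the points y m are arbitrary, so that y is a total sequence. *)
have /choice[y yP] (m : nat) :
    exists z, X m z /\ ((n0 <= m)%N -> ball x (e / 2) z).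
  have [n0m|_] := leqP n0 m; last by have [z Xz] := X_neq0 m; exists z.
  have [z Xz zx] := Xn0 _ _ n0n n0m _ Xx.
  by exists z; split=> // _; exact: ball_sym.
have [F [UF yF]] := ultraFilterLemma (fmap_proper_filter y eventually_filter).
have Fy (P : set N) : (\forall m \near \oo, P (y m)) -> F P by exact: yF.
have [l Fl] : exists l : N, F --> l.
  apply: ultra_near_compact_cvg => // d d0.
  have [n1 Xn1] := X_cauchy_ex d0.
  exists (X n1) => //; apply: Fy; exists n1 => // m /= n1m.
  by apply: Xn1 n1m (leqnn _) _ _; exact: (yP m).1.
exists l.
  move=> k _ B /Fl FB.
  suff FX : F (\bigcup_(m in [set m | (k <= m)%N]) X m).
    exact: filter_ex (filterI FX FB).
  by apply: Fy; exists k => // m /= km; exists m => //; exact: (yP m).1.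
have Fx : F (ball x (e / 2)).
  by apply: Fy; exists n0 => // m /= n0m; exact: (yP m).2.
have [z [lz xz]] := filter_ex (filterI (Fl _ (nbhsx_ballx l _ e20)) Fx).
exact: ball_splitl lz xz.
Qed.

End limit_set.

Section hausdorff.
Context {R : realType} {N : metricType R}.

(** The infimum of admissible radii is taken in the reals, where the infimum of
the empty set is 0.  If no radius were admissible the distance would vanish,
the two sets would coincide, and then radius 1 would be admissible. *)
Lemma hausdorff_dist_lt (X Y : nonempty_compact N) (e : R) :
  hausdorff_dist X Y < e -> X `<=` set_ball Y e.
Proof.
pose E (Z : set N) :=
  [set d : R | [/\ 0 < d, X `<=` set_ball Z d & Z `<=` set_ball X d]].
move=> XYe; have [E0|E0] := pselect (E Y !=set0).
  by have [d [_ XY _] /ltW de] := inf_lt E0 XYe; exact: subset_trans (set_ballW de).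
have XY0 : mdist X Y = 0.
  rewrite nonempty_compact_mdistE /hausdorff_dist -/(E Y).
  by have /nonemptyPn -> := E0; rewrite inf0.
exfalso; apply: E0; rewrite -(mdist_positivity _ _ XY0).
by exists 1; split=> // x Xx; exists x => //; exact: ballxx.
Qed.

Lemma hausdorff_dist_le (X Y : set N) (e : R) : 0 < e ->
  X `<=` set_ball Y e -> Y `<=` set_ball X e -> hausdorff_dist X Y <= e.
Proof.
move=> e0 XY YX; apply: ge_inf; last by split.
by exists 0 => d [/ltW].
Qed.

Lemma nonempty_compact_complete :
  metric_complete N -> metric_complete (nonempty_compact N).
Proof.
move=> cN X /cauchy_ballP cX.
have X_cauchy (e : R) : 0 < e ->
    \forall m & n \near \oo, (X m : set N) `<=` set_ball (X n) e.
  move=> /cX; rewrite near_map2; apply: filterS => -[m n] /=.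
  by rewrite ballEmdist /= nonempty_compact_mdistE => /hausdorff_dist_lt.
have X_compact n : compact (X n) by exact: compact_carrierP.
have X_neq0 n : (X n : set N) !=set0 by exact: compact_carrier_neq0.
have L0 : limit_set X !=set0.
  have [n0 _ /(_ n0 (leqnn n0)) XL] :=
    sub_limit_set X_cauchy cN X_compact X_neq0 ltr01.
  by have [x /XL[l Ll _]] := X_neq0 n0; exists l.
exists (NonemptyCompact (limit_set_compact X_cauchy cN X_compact) L0).
apply/cvg_ballP => e e0; have e20 : 0 < e / 2 by rewrite divr_gt0.
near=> n; rewrite ballEmdist /= nonempty_compact_mdistE /=.
apply: (@le_lt_trans _ _ (e / 2)); last by rewrite ltr_pdivrMr// ltr_pMr// ltr1n.
apply: hausdorff_dist_le => //; near: n.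
- exact: limit_set_sub.
- exact: sub_limit_set.
Unshelve. all: by end_near. Qed.

End hausdorff.

Lemma prod_complete (R : realType) (M N : metricType R) :
  metric_complete M -> metric_complete N -> metric_complete (M * N)%type.
Proof.
move=> cM cN u /cauchy_ballP cu.
have [a ua] : exists a : M, (fst \o u) @ \oo --> a.
  apply: cM; apply/cauchy_ballP => e /cu.
  by rewrite !near_map2; apply: filterS => -[m n] /= [].
have [b ub] : exists b : N, (snd \o u) @ \oo --> b.
  apply: cN; apply/cauchy_ballP => e /cu.
  by rewrite !near_map2; apply: filterS => -[m n] /= [].
exists (a, b); apply/cvg_ballP => e e0.
have ae : \forall n \near \oo, ball a e (u n).1 by exact: cvg_ball ua _ e0.
have be : \forall n \near \oo, ball b e (u n).2 by exact: cvg_ball ub _ e0.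
by apply: filterS (filterI ae be) => n [].
Qed.

(** An inclusion between 1-Lipschitz images is a closed condition for the
Hausdorff distance: go from p x to p y with y in X n, write p y = q z with z in
X n, and come back to some q w with w in L.  The inclusion is enough here: used
twice, it gives the equality of the two projections. *)
Lemma image_sub_limit (R : realType) (M N : metricType R) (p q : M -> N)
    (X : nat -> nonempty_compact M) (L : nonempty_compact M) :
  (forall x y e, ball x e y -> ball (p x) e (p y)) ->
  (forall x y e, ball x e y -> ball (q x) e (q y)) ->
  X @ \oo --> L ->
  (forall n, p @` X n `<=` q @` X n) -> p @` L `<=` q @` L.
Proof.
move=> p1 q1 XL pq _ [x Lx <-].
have /closure_id -> : closed (q @` L).
  apply: compact_closed; first exact: metric_hausdorff.
  apply: continuous_compact (compact_carrierP L).
  apply: continuous_subspaceT => y; apply/cvg_ballP => e e0.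
  by near=> z; apply: q1; near: z; exact: nbhsx_ballx.
move=> B /nbhs_ballP[e /= e0 pxB].
have e20 : 0 < e / 2 by rewrite divr_gt0.
near \oo => n.
have LXn : hausdorff_dist L (X n) < e / 2.
  have : ball L (e / 2) (X n) by near: n; exact: cvg_ball XL _ e20.
  by rewrite ballEmdist.
have XnL : hausdorff_dist (X n) L < e / 2.
  by rewrite -nonempty_compact_mdistE metric_sym.
have [y Xy /p1 yx] := hausdorff_dist_lt LXn Lx.
have [z Xz zy] : (q @` X n) (p y) by apply: pq; exists y.
have [w Lw /q1 wz] := hausdorff_dist_lt XnL Xz.
exists (q w); split; first by exists w.
apply: pxB; apply: ball_sym; apply: ball_splitl wz _; rewrite zy.
exact: ball_sym.
Unshelve. all: by end_near. Qed.

Theorem proposition2p15 (R : realType) (V : metricType R) :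
  metric_complete V -> metric_complete (DS V).
Proof.
move=> cV f /cauchy_ballP cf.
have [L fL] : exists L : nonempty_compact (V * V)%type,
    (fun n => DS_compact (f n)) @ \oo --> L.
  apply: nonempty_compact_complete; first exact: prod_complete.
  by apply/cauchy_ballP => e /cf; rewrite !near_map2.
have Lproj : fst @` (L : set (V * V)) = snd @` (L : set (V * V)).
  apply/seteqP; split; apply: (image_sub_limit _ _ fL) => //.
  - by move=> x y e [].
  - by move=> x y e [].
  - by move=> n; rewrite (DS_proj (f n)).
  - by move=> x y e [].
  - by move=> x y e [].
  - by move=> n; rewrite (DS_proj (f n)).
exists (MkDS Lproj); apply/cvg_ballP => e e0.
exact: cvg_ball fL _ e0.
Qed.
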